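(* The discrete semigroup $\mathbf{ID}_{\infty}$ does not embed topologically isomorphically into any Hausdorff compact topological semigroup; that is, for every Hausdorff compact topological semigroup $S$ there is no injective semigroup homomorphism $\mathbf{ID}_{\infty}\to S$ which is a homeomorphism of the discrete space $\mathbf{ID}_{\infty}$ onto its image with the subspace topology.
   Context: A partial cofinite isometry of the set of integers $\mathbb{Z}$ is a partial map $\alpha\colon\mathbb{Z}\rightharpoonup\mathbb{Z}$ such that $\mathbb{Z}\setminus\operatorname{dom}\alpha$ and $\mathbb{Z}\setminus\operatorname{ran}\alpha$ are finite and $|(x)\alpha-(y)\alpha|=|x-y|$ for all $x,y\in\operatorname{dom}\alpha$. $\mathbf{ID}_{\infty}$ is the semigroup (an inverse monoid) of all partial cofinite isometries of $\mathbb{Z}$ under composition of partial maps (maps written on the right). A topological semigroup is a topological space with a jointly continuous semigroup operation. *)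

(* Defs.v *)
From HB Require Import structures.
From mathcomp Require Import all_boot all_order all_algebra.
From mathcomp Require Import all_classical all_reals all_analysis.

Set Implicit Arguments.
Unset Strict Implicit.
Unset Printing Implicit Defensive.

Import Order.TTheory GRing.Theory Num.Theory.

Local Open Scope classical_set_scope.
Local Open Scope ring_scope.

(** Partial maps of [int] are functions [int -> option int], with [None] for
    undefined. *)

Definition pdom (a : int -> option int) : set int := [set x | a x <> None].

Definition pran (a : int -> option int) : set int :=
  [set y | exists x, a x = Some y].

(** Maps act on the right: [(x)(ab) = ((x)a)b]. *)
Definition pcomp (a b : int -> option int) : int -> option int :=
  fun x => obind b (a x).

Definition partial_isometry (a : int -> option int) : Prop :=
  forall x y x' y' : int,
    a x = Some x' -> a y = Some y' -> `|x' - y'| = `|x - y|.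

Definition cofinite_isometry (a : int -> option int) : Prop :=
  [/\ finite_set (~` pdom a), finite_set (~` pran a) & partial_isometry a].

Lemma partial_isometry_inj a (x y z : int) :
  partial_isometry a -> a x = Some z -> a y = Some z -> x = y.
Proof.
move=> ia ax ay; apply/eqP.
by rewrite -subr_eq0 -normr_eq0 -(ia _ _ _ _ ax ay) subrr normr0.
Qed.

Lemma cofinite_isometry_comp a b :
  cofinite_isometry a -> cofinite_isometry b ->
  cofinite_isometry (pcomp a b).
Proof.
move=> [da ra ia] [db rb ib]; split.
- have fpre : finite_set (a @^-1` (Some @` (~` pdom b))).
    apply: finite_preimage; last exact: finite_image.
    move=> x y /set_mem[z _ az] _ axy.
    by apply: (partial_isometry_inj ia (esym az)); rewrite -axy.
  apply: (sub_finite_set (B := ~` pdom a `|` a @^-1` (Some @` (~` pdom b)))).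
    move=> x; rewrite /pdom /pcomp /=; case ax: (a x) => [y|] //= nby.
      by right; exists y.
    by left; apply.
  by rewrite finite_setU.
- pose b0 := fun y => odflt 0 (b y).
  apply: (sub_finite_set (B := ~` pran b `|` b0 @` (~` pran a))).
    move=> z nz; have [[y byz]|] := pselect (pran b z); last by left.
    right; exists y; last by rewrite /b0 byz.
    by move=> [x axy]; apply: nz; exists x; rewrite /pcomp axy.
  by rewrite finite_setU; split=> //; exact: finite_image.
- move=> x y x' y'; rewrite /pcomp.
  case ax: (a x) => [u|] //= bu; case ay: (a y) => [v|] //= bv.
  by rewrite (ib _ _ _ _ bu bv); exact: ia.
Qed.

Record IDinf : Type := MkIDinf {
  idinf_map :> int -> option int ;
  idinf_mapP : cofinite_isometry idinf_map }.

HB.instance Definition _ := gen_eqMixin IDinf.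
HB.instance Definition _ := gen_choiceMixin IDinf.

Definition idinf_mul (a b : IDinf) : IDinf :=
  MkIDinf (cofinite_isometry_comp (idinf_mapP a) (idinf_mapP b)).

Lemma idinf_eq (a b : IDinf) : idinf_map a = idinf_map b -> a = b.
Proof.
case: a b => [a pa] [b pb] /= eab; case: _ / eab pb => pb.
by congr MkIDinf; exact: Prop_irrelevance.
Qed.

Lemma idinf_mulA : associative idinf_mul.
Proof.
move=> a b c; apply: idinf_eq; apply/funext => x /=.
by rewrite /pcomp /=; case: (a x).
Qed.

HB.instance Definition _ := isSemigroup.Build IDinf idinf_mulA.

HB.instance Definition _ :=
  DiscreteTopology.copy IDinf (discrete_topology IDinf).

HB.mixin Record isTopologicalSemigroup S & Topological S & Semigroup S := {
  mulg_continuous : continuous (fun p : S * S => (p.1 * p.2)%g)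
}.

#[short(type="topologicalSemigroupType")]
HB.structure Definition TopologicalSemigroup :=
  {S of Topological S & Semigroup S & isTopologicalSemigroup S}.

Lemma idinf_mul_continuous :
  continuous (fun p : IDinf * IDinf => (p.1 * p.2)%g).
Proof.
move=> [a b] U /= /nbhs_singleton Uab.
exists ([set a], [set b]); first by split; exact: discrete_set1.
by move=> [_ _] [/= -> ->].
Qed.

HB.instance Definition _ :=
  isTopologicalSemigroup.Build IDinf idinf_mul_continuous.

Definition homeomorphism (X Y : topologicalType) (h : X -> Y) : Prop :=
  continuous h /\
  exists g : Y -> X, [/\ cancel h g, cancel g h & continuous g].

Definition corestrict (X Y : Type) (f : X -> Y) (x : X) : range f :=
  exist _ (f x) (mem_set (imageT f x)).

(** The type [range f] carries the initial topology of its inclusion in [Y],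
    that is, the subspace topology. *)
Definition homeomorphism_onto_image (X Y : topologicalType) (f : X -> Y) :
  Prop := homeomorphism (corestrict f : X -> range f).

(* Main.v *)
Require Import Defs.
From HB Require Import structures.
From mathcomp Require Import all_boot all_order all_algebra.
From mathcomp Require Import all_classical all_reals all_analysis.

(** The group of units of [IDinf] contains the translations of the integers,
    an infinite cyclic group, and already this group cannot sit as a discrete
    subspace in a compact Hausdorff topological semigroup.  Let [x n] and [y n]
    be the images of the translations by [n] and by [- n].  By compactness the
    sequence of pairs [(x n, y n)] clusters at some [(s, v)], and [s * v] is the
    image [c] of the identity, because every product [x n * y n] is [c].  By
    joint continuity [x m * y n] is near [c] whenever [(x m, y m)] and
    [(x n, y n)] are both near [(s, v)], which happens for some [m < n]
    ([semigroup_recurrence]).  But [x m * y n] is the image of the translation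
    by [m - n], which is not the identity, while discreteness of the image
    isolates [c] from all other image points ([embedding_isolated]). *)

Import Order.TTheory GRing.Theory Num.Theory.

Local Open Scope classical_set_scope.

(** A sequence in a compact group has quotients of distinct terms arbitrarily
    near the identity.  A semigroup offers no inverses, and inversion could fail
    to be continuous, so [y n] stands in for the inverse of [x n], and
    clustering is taken for the pairs [(x n, y n)] at once. *)
Lemma semigroup_recurrence (S : topologicalSemigroupType) (x y : nat -> S)
    (c : S) (U : set S) :
  hausdorff_space S -> compact [set: S] ->
  (forall n, x n * y n = c)%g -> nbhs c U ->
  exists m n, (m < n)%N /\ U (x m * y n)%g.
Proof.
move=> hS cS xyc Uc.
have cSS : compact [set: S * S] by rewrite -setXTT; exact: compact_setX.
pose F := (fun n => (x n, y n)) @ \oo.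
have [[s v] [_ Fsv]] := cSS F _ filterT.
have recur N A : nbhs (s, v) A -> exists2 n, (N <= n)%N & A (x n, y n).
  have Ftail : F ((fun n => (x n, y n)) @` [set n | (N <= n)%N]).
    by exists N => // n Nn; exists n.
  by move=> /(Fsv _ _ Ftail)[_ [[n Nn <-] An]]; exists n.
have mulc := @mulg_continuous S (s, v).
have svc : (s * v)%g = c.
  apply: hS => A B Asv Bc; exists c; split; last exact: nbhs_singleton.
  by have [n _ /=] := recur 0%N _ (mulc _ Asv); rewrite xyc.
have [[W V] [/= Ws Vv] WVU] : nbhs (s, v) (fun p => U (p.1 * p.2)%g).
  by apply: mulc; rewrite /= svc.
have WVsv : nbhs (s, v) (W `*` V) by exists (W, V).
have [m _ [Wm _]] := recur 0%N _ WVsv; have [n mn [_ Vn]] := recur m.+1 _ WVsv.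
by exists m, n; split=> //; exact: (WVU (x m, y n)).
Qed.

(** The singleton of [a] is open in [X], so its image is open in [range f], that
    is, the trace on [range f] of an open set of [Y]. *)
Lemma embedding_isolated (X : discreteTopologicalType) (Y : topologicalType)
    (f : X -> Y) (a : X) :
  homeomorphism_onto_image f ->
  exists2 U, nbhs (f a) U & forall x, U (f x) -> x = a.
Proof.
move=> [_ [g [fK _ gc]]].
have : nbhs (corestrict f a) (g @^-1` [set a]).
  by apply: gc; rewrite fK; exact: discrete_set1.
move=> [_ [[U oU <-] /= Ua] Ug]; exists U; first exact: open_nbhs_nbhs.
by move=> x Ux; rewrite -(fK x); exact: (Ug (corestrict f x)).
Qed.

Lemma translation_cofinite_isometry (k : int) :
  cofinite_isometry (fun x => Some (x + k)%R).
Proof.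
split.
- by rewrite (_ : ~` _ = set0) // -subset0 => x /=; apply.
- rewrite (_ : ~` _ = set0) // -subset0 => y /=; apply.
  by exists (y - k)%R; rewrite subrK.
- by move=> x y _ _ [<-] [<-]; rewrite opprD addrACA subrr addr0.
Qed.

Definition translation (k : int) : IDinf :=
  MkIDinf (translation_cofinite_isometry k).

Lemma translationD (j k : int) :
  (translation j * translation k)%g = translation (j + k)%R.
Proof. by apply: idinf_eq; apply/funext => x; rewrite /= /pcomp /= addrA. Qed.

Lemma translation_inj : injective translation.
Proof.
by move=> j k /(congr1 (fun a : IDinf => a 0%R)) [] /=; rewrite !add0r.
Qed.

Theorem mainTheorem8 (S : topologicalSemigroupType) :
  hausdorff_space S -> compact [set: S] ->
  ~ exists f : {multiplicative IDinf -> S},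
      injective f /\ homeomorphism_onto_image f.
Proof.
move=> hS cS [f [_ fhomeo]].
have [U U1 Uisol] := embedding_isolated _ _ f (translation 0) fhomeo.
have [|m [n [mn]]] := semigroup_recurrence S
    (fun n => f (translation n%:Z)) (fun n => f (translation (- n%:Z)%R))
    (f (translation 0)) U hS cS _ U1.
  by move=> n; rewrite -gmulfM translationD subrr.
rewrite -gmulfM translationD => /Uisol /translation_inj /eqP.
by rewrite subr_eq0 eqz_nat (ltn_eqF mn).
Qed.
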